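(* Let $L_n$ and $C_n$ be the numbers of pure luck guesses and of certified correct guesses in the card guessing game with complete feedback after a single shelf shuffle of $n$ cards. The trivariate generating function $S(z,v,w)=\sum_{n\ge1}\mathbb E(v^{L_n}w^{C_n})z^n$ is given by $$S(z,v,w)=\frac{zw+\dfrac{\frac{z^2w}{2}}{1-\frac{zw}{2}}}{1-\frac{zv}{2}-\dfrac{\frac z2}{1-\frac{zw}{2}}+\frac z2}=\frac{2zw\bigl(2+(1-w)z\bigr)}{4+w(v-1)z^2-2z(v+w)}.$$
   Context: Single shelf shuffle: an ordered deck of $n$ cards labelled $1,\dots,n$ (card $1$ on top, card $n$ at the bottom) is given. Cards are drawn one by one from the bottom of the deck (so in the order $n,n-1,\dots,1$) and put on an initially empty pile; each drawn card is placed, independently, at the top or at the bottom of the pile with probability $1/2$ each. The final pile is the shuffled deck. Game: cards are drawn one after the other from the top of the shuffled deck. Before each draw the player guesses the label of the card; afterwards the card is shown (complete feedback). The player uses the following optimal strategy: the first guess is card $1$; as long as neither card $n-1$ nor card $n$ has been shown, the next guess is the label immediately following that of the most recently shown card; once one of the cards $n-1$ or $n$ has been shown, the player guesses the remaining (not yet shown) cards in descending order. A correct guess is certified if, conditionally on the cards shown before it, it is correct with probability one; it is a pure luck guess if, conditionally on the cards shown before it, it was correct with probability one-half. Every correct guess is of exactly one of these types; $L_n$ counts the pure luck guesses and $C_n$ the certified correct guesses, so $L_n+C_n$ is the total number of correct guesses (in particular $L_1=0$, $C_1=1$). The identity is understood as an identity of formal power series in $z$ with coefficients polynomials in $v,w$.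 *)

(* Defs.v *)
From HB Require Import structures.
From mathcomp Require Import all_boot all_order all_algebra.
From mathcomp Require Import boolp mpoly.

Set Implicit Arguments.
Unset Strict Implicit.
Unset Printing Implicit Defensive.

Import GRing.Theory.
Local Open Scope ring_scope.

(******************************************************************************)
(* Formal power series over a commutative ring R, with the Cauchy product.    *)
(* A series is a unit iff its constant coefficient is, so that x / y is the   *)
(* genuine quotient whenever the constant coefficient of y is invertible.     *)
(* Equality and choice on the carrier nat -> R are the classical ones.        *)
(******************************************************************************)

Record fps (R : Type) := Fps { fps_coef : nat -> R }.
Coercion fps_coef : fps >-> Funclass.

HB.instance Definition _ (R : Type) := gen_eqMixin (fps R).
HB.instance Definition _ (R : Type) := gen_choiceMixin (fps R).

Lemma fpsP (R : Type) (f g : fps R) : f =1 g -> f = g.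
Proof. by case: f g => [f] [g] /= /funext->. Qed.

Section FpsRing.
Variable R : comUnitRingType.
Implicit Types f g h : fps R.

Definition fps_zero : fps R := Fps (fun=> 0).
Definition fps_opp f : fps R := Fps (fun n => - f n).
Definition fps_add f g : fps R := Fps (fun n => f n + g n).

Fact fps_addA : associative fps_add.
Proof. by move=> f g h; apply: fpsP => n /=; rewrite addrA. Qed.
Fact fps_addC : commutative fps_add.
Proof. by move=> f g; apply: fpsP => n /=; rewrite addrC. Qed.
Fact fps_add0 : left_id fps_zero fps_add.
Proof. by move=> f; apply: fpsP => n /=; rewrite add0r. Qed.
Fact fps_addN : left_inverse fps_zero fps_opp fps_add.
Proof. by move=> f; apply: fpsP => n /=; rewrite addNr. Qed.

HB.instance Definition _ :=
  GRing.isZmodule.Build (fps R) fps_addA fps_addC fps_add0 fps_addN.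

Definition fpsC (c : R) : fps R := Fps (fun n => if n == 0%N then c else 0).

Definition fps_mul f g : fps R :=
  Fps (fun n => \sum_(i < n.+1) f i * g (n - i)%N).

Definition fps_trunc n f : {poly R} := \poly_(i < n.+1) f i.

Lemma coef_fps_trunc n f i : (i <= n)%N -> (fps_trunc n f)`_i = f i.
Proof. by move=> le_in; rewrite coef_poly ltnS le_in. Qed.

Lemma coef_fps_mul n f g i :
  (i <= n)%N -> fps_mul f g i = (fps_trunc n f * fps_trunc n g)`_i.
Proof.
move=> le_in; rewrite coefM; apply: eq_bigr => j _.
by rewrite !coef_fps_trunc // (leq_trans _ le_in) ?leq_subr // -ltnS.
Qed.

Lemma eq_coefM (p p' q q' : {poly R}) n :
    (forall i, (i <= n)%N -> p`_i = p'`_i) ->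
    (forall i, (i <= n)%N -> q`_i = q'`_i) ->
  (p * q)`_n = (p' * q')`_n.
Proof.
move=> eqp eqq; rewrite !coefM; apply: eq_bigr => i _.
by rewrite eqp ?eqq ?leq_subr // -ltnS.
Qed.

Fact fps_mulC : commutative fps_mul.
Proof.
by move=> f g; apply: fpsP => n; rewrite !(@coef_fps_mul n) // mulrC.
Qed.

Fact fps_mulA : associative fps_mul.
Proof.
move=> f g h; apply: fpsP => n; rewrite !(@coef_fps_mul n) //.
transitivity ((fps_trunc n f * (fps_trunc n g * fps_trunc n h))`_n).
  by apply: eq_coefM => // i le_in; rewrite coef_fps_trunc // (@coef_fps_mul n).
rewrite mulrA; apply: eq_coefM => // i le_in.
by rewrite coef_fps_trunc // (@coef_fps_mul n).
Qed.

Fact fps_mul1 : left_id (fpsC 1) fps_mul.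
Proof.
move=> f; apply: fpsP => n /=; rewrite big_ord_recl /= mul1r subn0.
by rewrite big1 ?addr0 // => i _; rewrite mul0r.
Qed.

Fact fps_mulDl : left_distributive fps_mul fps_add.
Proof.
move=> f g h; apply: fpsP => n /=; rewrite -big_split /=.
by apply: eq_bigr => i _; rewrite mulrDl.
Qed.

Fact fps_oner_neq0 : fpsC 1 != 0.
Proof.
apply/eqP => /(congr1 (fun f : fps R => f 0%N)) /= /eqP.
by rewrite oner_eq0.
Qed.

HB.instance Definition _ := GRing.Zmodule_isComNzRing.Build (fps R)
  fps_mulA fps_mulC fps_mul1 fps_mulDl fps_oner_neq0.

(* The list of the first n coefficients of the inverse of f, by the usual     *)
(* recursion b_n = - f_0^-1 * (f_1 b_(n-1) + ... + f_n b_0).                  *)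
Fixpoint fps_inv_seq f n : seq R :=
  if n isn't m.+1 then [::] else
  let s := fps_inv_seq f m in
  rcons s (if m is 0 then (f 0%N)^-1
           else - (f 0%N)^-1 * \sum_(i < m) f i.+1 * s`_(m - i.+1)).

Definition fps_unit : pred (fps R) := fun f => f 0%N \is a GRing.unit.

Definition fps_inv f : fps R :=
  if fps_unit f then Fps (fun n => (fps_inv_seq f n.+1)`_n) else f.

Lemma size_fps_inv_seq f n : size (fps_inv_seq f n) = n.
Proof. by elim: n => //= n IHn; rewrite size_rcons IHn. Qed.

Lemma nth_fps_inv_seq f n i :
  (i < n)%N -> (fps_inv_seq f n)`_i = (fps_inv_seq f i.+1)`_i.
Proof.
elim: n => // n IHn; rewrite ltnS leq_eqVlt => /predU1P[-> // | lt_in].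
by rewrite [LHS]nth_rcons size_fps_inv_seq lt_in IHn.
Qed.

Fact fps_mulVr : {in fps_unit, left_inverse 1 fps_inv *%R}.
Proof.
move=> f Uf; have fU : fps_unit f = true := Uf.
rewrite mulrC; apply: fpsP => n; rewrite /fps_inv fU /= big_ord_recl subn0.
case: n => [|n]; first by rewrite big_ord0 addr0 /= divrr.
rewrite /= -[rcons (fps_inv_seq f n) _]/(fps_inv_seq f n.+1).
rewrite nth_rcons size_fps_inv_seq ltnn eqxx mulrA mulrN divrr // mulN1r.
apply/eqP; rewrite addrC subr_eq0; apply/eqP/eq_bigr => i _.
by rewrite -[in LHS]subSS nth_fps_inv_seq // subSS ltnS leq_subr.
Qed.

Fact fps_unitPl f g : g * f = 1 -> fps_unit f.
Proof.
move/(congr1 (fun h : fps R => h 0%N)); rewrite /= big_ord1 => gf1.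
by apply/unitrPr; exists (g 0%N); rewrite mulrC.
Qed.

Fact fps_inv_out : {in [predC fps_unit], fps_inv =1 id}.
Proof.
by move=> f nUf; rewrite /fps_inv; have /negPf -> : ~~ fps_unit f by [].
Qed.

HB.instance Definition _ := GRing.ComNzRing_hasMulInverse.Build (fps R)
  fps_mulVr fps_unitPl fps_inv_out.

Definition fpsX : fps R := Fps (fun n => if n == 1%N then 1 else 0).

End FpsRing.

(******************************************************************************)
(* The shelf shuffle. A deck is listed from top to bottom, the cards being    *)
(* labelled 1, ..., n. The randomness is one fair coin per card: card i.+1    *)
(* goes to the top of the pile iff the i-th coin is true; the n coins are     *)
(* independent, i.e. the law on the 2 ^ n outcomes is uniform.                *)
(******************************************************************************)

Definition coins (n : nat) := {ffun 'I_n -> bool}.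

Definition place (pile : seq nat) (card : nat) (top : bool) : seq nat :=
  if top then card :: pile else rcons pile card.

Definition shelf_shuffle (n : nat) (omega : coins n) : seq nat :=
  foldl (fun pile (i : 'I_n) => place pile i.+1 (omega i)) [::] (rev (enum 'I_n)).

Definition prob (n : nat) (A : {set coins n}) : rat :=
  #|A|%:R / (2 ^ n)%:R.

Definition cond_prob (n : nat) (A B : {set coins n}) : rat :=
  prob (A :&: B) / prob B.

Definition expect (n : nat) (V : lmodType rat) (F : coins n -> V) : V :=
  \sum_omega prob [set omega] *: F omega.

(* shown is the list of cards already seen, the most recent one last. For     *)
(* shown = [::] the guess is card 1; \max picks the largest unseen card.      *)
Definition guess (n : nat) (shown : seq nat) : nat :=
  if (n.-1 \in shown) || (n \in shown)
  then \max_(1 <= c < n.+1 | c \notin shown) c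
  else (last 0%N shown).+1.

(* Positions are numbered from 0: i cards are shown before the draw at i.     *)
Definition shown_before (n : nat) (omega : coins n) (i : nat) : seq nat :=
  take i (shelf_shuffle omega).

Definition drawn_card (n : nat) (omega : coins n) (i : nat) : nat :=
  nth 0%N (shelf_shuffle omega) i.

Definition correct (n : nat) (omega : coins n) (i : nat) : bool :=
  drawn_card omega i == guess n (shown_before omega i).

Definition success_prob (n : nat) (omega : coins n) (i : nat) : rat :=
  cond_prob [set omega' : coins n | correct omega' i]
            [set omega' : coins n | shown_before omega' i == shown_before omega i].

Definition pure_luck (n : nat) (omega : coins n) : nat :=
  #|[set i : 'I_n | correct omega i && (success_prob omega i == 1 / 2%:R)]|.

Definition certified (n : nat) (omega : coins n) : nat :=
  #|[set i : 'I_n | correct omega i && (success_prob omega i == 1)]|.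

(* Coefficients in z are polynomials in v = 'X_0 and w = 'X_1 over rat.       *)
Definition vX : {mpoly rat[2]} := 'X_(inord 0).
Definition wX : {mpoly rat[2]} := 'X_(inord 1).

Definition luck_cert_gf : fps {mpoly rat[2]} :=
  Fps (fun n => if n == 0%N then 0 else
    expect (fun omega : coins n =>
              vX ^+ pure_luck omega * wX ^+ certified omega)).

(* Main.v *)
(** The shuffled deck lists the cards sent to the top in increasing order, then
    card n, then the other cards in decreasing order.  Call the coin of card c
    "up" if c goes to the top, and let the fictitious card 0 be up.  While
    neither n - 1 nor n has been shown, the last card shown is an up card t, the
    guess t + 1 is right iff t + 1 is up, and flipping the coin of t + 1 leaves
    the shown cards unchanged: such a guess is pure luck.  Afterwards the
    remaining cards come out in decreasing order, so every guess is certified.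
    With n = m + 1, L_n thus counts the pairs (t, t + 1) of consecutive up cards
    among 0, ..., m, and C_n is the number of cards among 1, ..., m that are not
    up, plus one if m is up.  Splitting the expectation of the weights by the
    coin of card m gives a two-state linear recursion, whose generating series
    X (m up) and Y (m not up) satisfy 2X = 2 + z(vX + Y), 2Y = zw(X + Y), and
    S = z(wX + Y). *)
Require Import Defs.
From mathcomp Require Import all_boot all_order all_algebra.
From mathcomp Require Import boolp mpoly zify ring.
Import Order.TTheory GRing.Theory Num.Theory.
Local Open Scope ring_scope.
Set Implicit Arguments.
Unset Strict Implicit.
Unset Printing Implicit Defensive.

(** * The shape of the shuffled deck and its early prefixes *)

Section Deck.
Local Open Scope nat_scope.
Implicit Types (g : pred nat) (m n k i t : nat).

Definition tops g k := [seq c <- iota 1 k | g c.-1].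
Definition bottoms g k := [seq c <- iota 1 k | ~~ g c.-1].
Definition deck g m := tops g m ++ m.+1 :: rev (bottoms g m).

(* The coin of card t, with the convention that the absent card 0 lies on top. *)
Definition is_top g t := if t is k.+1 then g k else true.

Lemma topsS g k : tops g k.+1 = tops g k ++ (if g k then [:: k.+1] else [::]).
Proof. by rewrite /tops -[k.+1 in LHS]addn1 iotaD filter_cat /= add1n. Qed.

Lemma bottomsS g k :
  bottoms g k.+1 = bottoms g k ++ (if g k then [::] else [:: k.+1]).
Proof. by rewrite /bottoms -[k.+1 in LHS]addn1 iotaD filter_cat /= add1n; case: (g k). Qed.

(** Card [m.+1] meets an empty pile, so both values of its coin give the same deck. *)
Lemma tops_deckE g m : tops g m.+1 ++ rev (bottoms g m.+1) = deck g m.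
Proof.
by rewrite topsS bottomsS /deck; case: (g m); rewrite ?cats0 ?cats1 ?rev_rcons ?cat_rcons.
Qed.

Lemma mem_tops g k c : (c \in tops g k) = g c.-1 && (0 < c <= k).
Proof. by rewrite mem_filter mem_iota add1n ltnS. Qed.

Lemma mem_bottoms g k c : (c \in bottoms g k) = ~~ g c.-1 && (0 < c <= k).
Proof. by rewrite mem_filter mem_iota add1n ltnS. Qed.

Lemma mem_deck g m c : (c \in deck g m) = (0 < c <= m.+1).
Proof.
rewrite mem_cat inE mem_rev mem_tops mem_bottoms.
by case: (g _) => /=; lia.
Qed.

Lemma sorted_tops g k : sorted ltn (tops g k).
Proof. exact: (sorted_filter ltn_trans _ (iota_ltn_sorted _ _)). Qed.

Lemma sorted_bottoms g k : sorted ltn (bottoms g k).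
Proof. exact: (sorted_filter ltn_trans _ (iota_ltn_sorted _ _)). Qed.

Lemma gtn_trans : transitive gtn.
Proof. by move=> x y z /= xy yz; exact: ltn_trans yz xy. Qed.

Lemma sorted_deck_tail g m : sorted gtn (m.+1 :: rev (bottoms g m)).
Proof.
rewrite /= (path_sortedE gtn_trans) rev_sorted sorted_bottoms andbT.
by apply/allP=> c; rewrite mem_rev mem_bottoms => /and3P[_ _].
Qed.

Lemma uniq_deck g m : uniq (deck g m).
Proof.
rewrite cat_uniq /= rev_uniq.
rewrite (sorted_uniq ltn_trans ltnn (sorted_tops _ _)).
rewrite (sorted_uniq ltn_trans ltnn (sorted_bottoms _ _)) /=.
rewrite mem_rev mem_bottoms mem_tops ltnn !andbF /= andbT.
apply/hasPn => c; rewrite mem_rev mem_bottoms mem_tops => /andP[/negPf->].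
by [].
Qed.

Lemma size_deck g m : size (deck g m) = m.+1.
Proof.
have -> : m.+1 = size (iota 1 m.+1) by rewrite size_iota.
apply/perm_size/uniq_perm; rewrite ?uniq_deck ?iota_uniq // => c.
by rewrite mem_deck mem_iota add1n.
Qed.

Lemma last_tops g t : is_top g t -> last 0 (tops g t) = t.
Proof. by case: t => // t /= gt; rewrite topsS gt last_cat. Qed.

Lemma last_tops_le g t : last 0 (tops g t) <= t.
Proof.
case/lastP: (tops g t) (mem_tops g t) => [//|s x /(_ x)].
by rewrite last_rcons mem_rcons mem_head => /esym/and3P[].
Qed.

Lemma take_tops g k i : i <= size (tops g k) ->
  exists t, [/\ t <= k, is_top g t & take i (tops g k) = tops g t].
Proof.
elim: k => [|k IHk] lei; first by exists 0.
have [leik | ltki] := leqP i (size (tops g k)).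
  have [t [letk gt eqt]] := IHk leik; exists t; split=> //; first exact: leqW.
  by rewrite topsS takel_cat.
move: lei; rewrite topsS size_cat; case: ifP => gk /= lei; last by lia.
exists k.+1; split=> //; rewrite topsS gk take_oversize // size_cat /=; lia.
Qed.

Lemma tops_cat g t k : t <= k ->
  exists2 s, tops g k = tops g t ++ s & all (ltn t) s.
Proof.
move=> letk; exists [seq c <- iota t.+1 (k - t) | g c.-1].
  by rewrite /tops -filter_cat -add1n -iotaD subnKC.
by apply/allP=> c; rewrite mem_filter mem_iota => /andP[_ /andP[]].
Qed.

Lemma take_deck g m t : t <= m -> take (size (tops g t)) (deck g m) = tops g t.
Proof. by move=> /(tops_cat g)[s eqs _]; rewrite /deck eqs -catA take_size_cat. Qed.

(** If card [t.+1] is not up, the next card is a later up card or [m.+1], in either case larger than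
    [t.+1]. *)
Lemma nth_deck g m t : t < m -> (nth 0 (deck g m) (size (tops g t)) == t.+1) = g t.
Proof.
move=> lttm; have [s eqs alls] := tops_cat g lttm.
rewrite /deck eqs topsS -!catA nth_cat ltnn subnn; case: ifP => _ //=.
  by rewrite eqxx.
by case: s alls {eqs} => [_|c s /andP[ltc _]] /=; rewrite gtn_eqF.
Qed.

(** The deck has [m.+1] cards. A one-card deck is never early: its single guess is certified. *)
Definition early m (s : seq nat) := [&& 0 < m, m \notin s & m.+1 \notin s].

Lemma early_tops g m t : t < m -> early m (tops g t).
Proof. by move=> lttm; rewrite /early !mem_tops; case: (g _); case: (g _) => /=; lia. Qed.

(** Card [m.+1] follows the up cards, so an early prefix consists of up cards; since [m] is missing,
    they stop before it. *)
Lemma early_deck g m i : early m (take i (deck g m)) ->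
  exists t, [/\ t < m, is_top g t, take i (deck g m) = tops g t & i = size (tops g t)].
Proof.
case/and3P=> m_gt0 mN m1N.
have lei : i <= size (tops g m).
  rewrite leqNgt; apply: contra m1N => lti.
  rewrite /deck take_cat ltnNge ltnW //= mem_cat.
  by rewrite -(subnKC lti) addSnnS addKn mem_head orbT.
have eqt : take i (deck g m) = take i (tops g m) by rewrite takel_cat.
have [t [letm gt eqtt]] := take_tops lei.
exists t; split=> //; last by rewrite -eqtt size_takel.
- rewrite ltn_neqAle letm andbT; apply: contraNneq mN => eqtm.
  rewrite eqt eqtt eqtm mem_tops m_gt0 leqnn !andbT.
  by move: gt m_gt0; rewrite eqtm; case: (m) => // ?.
- by rewrite eqt.
Qed.

(** Once [m] or [m.+1] is out, the up cards up to [m] are exhausted; the rest is decreasing, so its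
    head is the largest unseen card. *)
Lemma late_deck g m i : i <= m -> ~~ early m (take i (deck g m)) ->
  nth 0 (deck g m) i = guess m.+1 (take i (deck g m)).
Proof.
move=> leim Nearly.
(* For [m = 0] nothing is shown yet and the guess is the only card 1. *)
case: (posnP m) => [m0|m_gt0].
  have i0 : i = 0 by lia.
  by rewrite m0 i0.
have {}Nearly : (m \in take i (deck g m)) || (m.+1 \in take i (deck g m)).
  by move: Nearly; rewrite /early m_gt0 -negb_or negbK.
rewrite /guess /= Nearly.
have lei : size (tops g m) <= i.
  rewrite leqNgt; apply: contraL Nearly => lti.
  rewrite /deck (takel_cat _ (ltnW lti)) negb_or; apply/andP; split; last first.
    by apply: (contra (@mem_take _ _ _ _)); rewrite mem_tops ltnn !andbF.
  (* The list is increasing: coming after [m], entry [i] would exceed [m]. *)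
  apply/negP => /(nthP 0)[j]; rewrite (size_takel (ltnW lti)) => ltji.
  rewrite nth_take // => eqm.
  have := sorted_ltn_nth ltn_trans 0 (sorted_tops g m) j i.
  rewrite !inE (ltn_trans ltji lti) lti eqm => /(_ isT isT ltji).
  have := mem_nth 0 lti; rewrite mem_tops => /and3P[_ _ le1].
  by rewrite /= ltnNge le1.
have lts : i < size (deck g m) by rewrite size_deck.
have dropE := drop_nth 0 lts.
have sd : sorted gtn (drop i (deck g m)).
  have -> : drop i (deck g m) = drop (i - size (tops g m)) (m.+1 :: rev (bottoms g m)).
    by rewrite /deck drop_cat ltnNge lei.
  apply: drop_sorted; exact: sorted_deck_tail.
have := uniq_deck g m; rewrite -{1}(cat_take_drop i (deck g m)) cat_uniq.
case/and3P=> _ /hasPn dis _.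
have in_s : nth 0 (deck g m) i \in deck g m by apply: mem_nth.
apply/eqP; rewrite eqn_leq; apply/andP; split.
  apply: (@leq_bigmax_seq _ _ _ id).
    by move: in_s; rewrite mem_deck mem_index_iota ltnS.
  by apply: dis; rewrite dropE mem_head.
apply/bigmax_leqP_seq => c; rewrite mem_index_iota ltnS -(mem_deck g) => cs cN.
move: cs; rewrite -{1}(cat_take_drop i (deck g m)) mem_cat (negPf cN) /=.
move: sd; rewrite dropE /= inE => sd /predU1P[-> //|cs].
apply: ltnW.
by move: sd; rewrite (path_sortedE gtn_trans) => /andP[/allP/(_ c cs)].
Qed.

(** Early positions are matched with up cards [t < m]: the position is the number of up cards in
    [1, ..., t], and the last card shown recovers [t]. *)
Lemma sum_early g m (F : nat -> nat) :
  \sum_(i < m.+1 | early m (take i (deck g m))) F (last 0 (take i (deck g m))) =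
  \sum_(t < m | is_top g t) F t.
Proof.
case: m => [|m]; first by rewrite big_ord0 big_pred0 // => i; rewrite /early.
have lt_size t : t <= m -> size (tops g t) < m.+2.
  move=> letm; rewrite ltnS (leq_trans (size_subseq (filter_subseq _ _))) //.
  by rewrite size_iota; lia.
rewrite (reindex_onto (fun t : 'I_m.+1 => inord (size (tops g t)) : 'I_m.+2)
  (fun i : 'I_m.+2 => inord (last 0 (take i (deck g m.+1))))) /=; last first.
  move=> i /early_deck[t [lttm gt -> isz]]; apply: val_inj => /=.
  by rewrite last_tops // inordK inordK -?isz.
apply: eq_big => [t|t /andP[]].
  rewrite inordK ?lt_size -1?ltnS // take_deck 1?ltnW // early_tops //=.
  apply/eqP/idP => [|gt]; last first.
    by apply: val_inj; rewrite /= last_tops // inordK.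
  (* If [t.+1] is not up, the last up card below it is smaller, so [t.+1] is not recovered. *)
  case: t => -[|t] lt_t //= /(congr1 val) /=; case gt: (g t) => //.
  have lst : last 0 (tops g t.+1) < t.+1.
    by rewrite topsS gt cats0 ltnS last_tops_le.
  rewrite inordK; last exact: ltn_trans lst lt_t.
  by move=> e; move: lst; rewrite e ltnn.
rewrite inordK ?lt_size -1?ltnS // take_deck 1?ltnW // => _ /eqP eqt.
by rewrite -[in RHS]eqt inordK // (leq_ltn_trans (last_tops_le _ _)).
Qed.

(** The late positions are the complement of the early ones, which are counted by the up cards among
    [0, ..., m - 1]. *)
Lemma late_count g m :
  \sum_(i < m.+1 | ~~ early m (take i (deck g m))) 1 =
  \sum_(t < m) ~~ g t + is_top g m.
Proof.
have early_late : m.+1 = \sum_(i < m.+1 | early m (take i (deck g m))) 1 +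
                         \sum_(i < m.+1 | ~~ early m (take i (deck g m))) 1.
  rewrite -[LHS](card_ord m.+1) -sum1_card.
  exact: (bigID (fun i : 'I_m.+1 => early m (take i (deck g m)))).
have tops_bottoms : m = \sum_(t < m | is_top g t) 1 + \sum_(t < m) ~~ is_top g t.
  rewrite [X in X + _]big_mkcond -big_split /= -[LHS](card_ord m) -sum1_card.
  by apply: eq_bigr => t _; case: is_top.
(* Coin [t] belongs to card [t.+1] and card 0 is up, so the shift adds only the term of card [m]. *)
have shift : \sum_(t < m) ~~ g t = \sum_(t < m) ~~ is_top g t + ~~ is_top g m.
  by rewrite -(big_ord_recr m (fun t : 'I_m.+1 => ~~ is_top g t : nat)) big_ord_recl.
move: early_late tops_bottoms; rewrite (sum_early g m (fun=> 1)) shift.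
by case: (is_top g m) => /=; lia.
Qed.
End Deck.

(** * Outcomes as predicates, and flipping one coin *)

Section Probability.
Variable n : nat.
Implicit Types om : coins n.

(** The default [true] past the last coin turns outcomes of all lengths into predicates on the
    naturals. *)
Definition coin om : pred nat := fun k => if insub k is Some i then om i else true.

Lemma coinE om (i : 'I_n) : coin om i = om i.
Proof. by rewrite /coin valK. Qed.

(** Cards arrive in decreasing order, so each new one lands outside all larger ones: in front of the
    top part or behind the bottom part. *)
Lemma shelf_shuffleE om :
  shelf_shuffle om = tops (coin om) n ++ rev (bottoms (coin om) n).
Proof.
have foldE (s : seq 'I_n) : foldr (fun (i : 'I_n) pile => place pile i.+1 (om i)) [::] s =
    [seq (val i).+1 | i : 'I_n <- s & coin om i] ++
    rev [seq (val i).+1 | i : 'I_n <- s & ~~ coin om i].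
  elim: s => //= i s ->; rewrite /place -coinE; case: (coin om i) => //=.
  by rewrite rev_cons rcons_cat.
rewrite /shelf_shuffle foldl_rev foldE /tops /bottoms.
rewrite -[1%N]addn0 iotaDl -val_enum_ord -map_comp !filter_map -!map_comp.
by [].
Qed.

Definition flip (t : 'I_n) om : coins n := [ffun i => if i == t then ~~ om i else om i].

Lemma flipK t : involutive (flip t).
Proof. by move=> om; apply/ffunP=> i; rewrite !ffunE; case: eqP => // _; rewrite negbK. Qed.

Lemma prob_gt0 (A : {set coins n}) om : om \in A -> 0 < prob A.
Proof.
move=> omA; rewrite divr_gt0 ?ltr0n ?expn_gt0 //.
by apply/card_gt0P; exists om.
Qed.

End Probability.

(** * Success probabilities and the two counts *)

Section Game.
Variable m : nat.
Implicit Types (om : coins m.+1) (i : nat).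

Lemma shelf_shuffle_deck om : shelf_shuffle om = deck (coin om) m.
Proof. by rewrite shelf_shuffleE tops_deckE. Qed.

Lemma shown_beforeE om i : shown_before om i = take i (deck (coin om) m).
Proof. by rewrite /shown_before shelf_shuffle_deck. Qed.

Lemma correct_late om i :
  (i <= m)%N -> ~~ early m (shown_before om i) -> correct om i.
Proof.
rewrite /correct /drawn_card shown_beforeE shelf_shuffle_deck => leim late.
by rewrite late_deck.
Qed.

(** The guess is [t.+1] for the last card shown [t], and its coin has index [t]. *)
Lemma correct_early om i :
  early m (shown_before om i) -> correct om i = coin om (last 0%N (shown_before om i)).
Proof.
move=> e; have := e; rewrite /correct /drawn_card /guess.
rewrite shown_beforeE shelf_shuffle_deck => /early_deck[t [lttm gt eqt ->]].
rewrite take_deck 1?ltnW // last_tops //=.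
case: ifP => [|_]; last by rewrite nth_deck.
move: e; rewrite shown_beforeE eqt => /and3P[_ /negPf-> /negPf->].
by [].
Qed.

(** The shown cards are the up cards among [1, ..., t], which depend only on coins of index below
    [t]. *)
Lemma shown_before_flip om i (t : 'I_m.+1) : early m (shown_before om i) ->
  last 0%N (shown_before om i) = t -> shown_before (flip t om) i = shown_before om i.
Proof.
rewrite !shown_beforeE => /early_deck[u [ltum gu -> ->]].
rewrite last_tops // => ut; have -> : tops (coin om) u = tops (coin (flip t om)) u.
  apply: eq_in_filter => c; rewrite mem_iota => /andP[c_gt0 ltc].
  have ltc' : (c.-1 < m.+1)%N by lia.
  rewrite -[c.-1]/(val (Ordinal ltc')) !coinE ffunE ifN //.
  by apply/eqP => /(congr1 val) /=; lia.
by rewrite take_deck // ltnW.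
Qed.

Lemma success_prob_late om i :
  (i <= m)%N -> ~~ early m (shown_before om i) -> success_prob om i = 1.
Proof.
move=> leim late; rewrite /success_prob /cond_prob (setIidPr _).
  by apply/divff/lt0r_neq0/(@prob_gt0 _ _ om); rewrite inE.
by apply/subsetP => om'; rewrite !inE => /eqP eqs; apply: correct_late; rewrite ?eqs.
Qed.

(** Flipping the coin of the guessed card preserves the conditioning event [B] and swaps correct and
    wrong guesses, so [A] fills half of [B]. *)
Lemma success_prob_early om i :
  early m (shown_before om i) -> success_prob om i = 1 / 2%:R.
Proof.
move=> e; rewrite /success_prob /cond_prob.
set A := [set _ | correct _ _]; set B := [set _ | _ == _].
have ltt : (last 0%N (shown_before om i) < m.+1)%N.
  have := e; rewrite shown_beforeE => /early_deck[t [lttm gt -> _]].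
  by rewrite last_tops // ltnS ltnW.
pose t := Ordinal ltt.
have cardB : #|B| = (#|A :&: B| * 2)%N.
  rewrite -(cardsID A B) setIC muln2 -addnn; congr addn.
  rewrite -[RHS](card_imset _ (inv_inj (flipK t))); apply: eq_card => om'.
  apply/idP/imsetP => [|[om'' + ->]]; rewrite !inE.
    case/andP=> nc /eqP eqs.
    have e' : early m (shown_before om' i) by rewrite eqs.
    have eqs' := shown_before_flip (t := t) e' (congr1 (last 0%N) eqs).
    exists (flip t om'); rewrite ?flipK // !inE eqs' eqs eqxx andbT.
    rewrite correct_early eqs' // eqs -[last _ _]/(val t) coinE ffunE eqxx -coinE.
    by rewrite correct_early // eqs in nc.
  case/andP=> cc /eqP eqs.
  have e' : early m (shown_before om'' i) by rewrite eqs.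
  have eqs' := shown_before_flip (t := t) e' (congr1 (last 0%N) eqs).
  rewrite eqs' eqs eqxx andbT.
  rewrite correct_early eqs' // eqs -[last _ _]/(val t) coinE ffunE eqxx -coinE negbK.
  by rewrite correct_early // eqs in cc.
have B_gt0 : (0 < #|B|)%N by apply/card_gt0P; exists om; rewrite inE.
rewrite /prob cardB natrM.
have AB_neq0 : #|A :&: B|%:R != 0 :> rat by rewrite pnatr_eq0; lia.
have pow_neq0 : (2 ^ m.+1)%:R != 0 :> rat by rewrite pnatr_eq0 expn_eq0.
by field; rewrite AB_neq0 pow_neq0.
Qed.

(** Late guesses have success probability 1, so the pure luck ones are the correct early ones; these
    are reindexed by the last card shown. *)
Lemma pure_luckE om :
  pure_luck om = (\sum_(t < m) is_top (coin om) t && coin om t)%N.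
Proof.
transitivity (\sum_(i < m.+1 | early m (take i (deck (coin om) m)))
    coin om (last 0 (take i (deck (coin om) m))))%N; last first.
  rewrite (sum_early _ _ (fun t => coin om t : nat)) big_mkcond /=.
  by apply: eq_bigr => t _; case: is_top.
rewrite /pure_luck -sum1_card [RHS]big_mkcond [LHS]big_mkcond.
apply: eq_bigr => i _.
rewrite inE -shown_beforeE; case: (boolP (early _ _)) => [e|late].
  by rewrite correct_early // success_prob_early // eqxx andbT; case: coin.
by rewrite success_prob_late // ?andbF // -ltnS.
Qed.

Lemma certifiedE om :
  certified om = (\sum_(t < m) ~~ coin om t + is_top (coin om) m)%N.
Proof.
rewrite -late_count /certified -sum1_card [RHS]big_mkcond [LHS]big_mkcond.
apply: eq_bigr => i _.
rewrite inE -shown_beforeE; case: (boolP (early _ _)) => [e|late] /=.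
  by rewrite success_prob_early // andbF.
by rewrite correct_late ?success_prob_late ?eqxx // -ltnS.
Qed.
End Game.

(** * Expectation by conditioning on the last coin *)

Section Mean.
Variable V : lmodType rat.
Implicit Types (n : nat) (G : pred nat -> V) (g : pred nat).

Definition mean n G : V := expect (fun om : coins n => G (coin om)).

Definition set_coin n b g : pred nat := fun k => if k == n then b else g k.

Lemma meanE n G : mean n G = (2 ^+ n)^-1 *: \sum_(om : coins n) G (coin om).
Proof.
rewrite scaler_sumr; apply: eq_bigr => om _.
by rewrite /prob cards1 natrX mul1r.
Qed.

Lemma eq_mean n G G' : G =1 G' -> mean n G = mean n G'.
Proof. by move=> eqG; rewrite !meanE; congr (_ *: _); apply: eq_bigr. Qed.

Lemma mean0 G : mean 0 G = G xpredT.
Proof.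
rewrite meanE expr0 invr1 scale1r (eq_bigr (fun=> G xpredT)) => [|om _].
  by rewrite sumr_const card_ffun card_ord card_bool.
by congr G; apply: funext => k; rewrite /coin; case: insubP => // -[].
Qed.

Lemma meanD n G G' : mean n (fun g => G g + G' g) = mean n G + mean n G'.
Proof. by rewrite !meanE big_split scalerDr. Qed.

Definition extend n (b : bool) (om : coins n) : coins n.+1 :=
  [ffun i => if unlift ord_max i is Some j then om j else b].

Lemma coin_extend n b (om : coins n) : coin (extend b om) = set_coin n b (coin om).
Proof.
apply: funext => k; rewrite /set_coin.
have [ltkn | ] := ltnP k n.
  rewrite ltn_eqF // -[k in LHS]/(val (widen_ord (leqnSn n) (Ordinal ltkn))) coinE ffunE.
  have -> : widen_ord (leqnSn n) (Ordinal ltkn) = lift ord_max (Ordinal ltkn).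
    by apply: val_inj; rewrite /= /bump leqNgt ltkn.
  by rewrite liftK -coinE.
rewrite leq_eqVlt => /predU1P[<-|ltnk].
  by rewrite eqxx -[n in LHS]/(val (@ord_max n)) coinE ffunE unlift_none.
by rewrite gtn_eqF // /coin !insubF //; lia.
Qed.

(** An outcome splits into its last coin and the other [n]; doubling cancels the probability
    one-half of the last coin. *)
Lemma meanS n G :
  mean n.+1 G *+ 2 =
  mean n (fun g => G (set_coin n true g)) + mean n (fun g => G (set_coin n false g)).
Proof.
pose restrict (om : coins n.+1) := (om ord_max, [ffun i => om (lift ord_max i)] : coins n).
rewrite -meanD !meanE -scaler_nat scalerA exprS invfM mulrA mulfV ?mul1r //; congr (_ *: _).
rewrite (reindex (fun p : bool * coins n => extend p.1 p.2)) /=; last first.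
  exists restrict => [[b om] _|om _].
    congr pair; first by rewrite ffunE unlift_none.
    by apply/ffunP => i; rewrite !ffunE liftK.
  by apply/ffunP => i; rewrite ffunE; case: unliftP => [j|] ->; rewrite ?ffunE.
rewrite -(pair_bigA _ (fun b om => G (coin (extend b om)))) /= big_bool -big_split.
by apply: eq_bigr => om _; rewrite !coin_extend.
Qed.
End Mean.

Lemma natr_mpoly_unit k : (k.+1%:R : {mpoly rat[2]}) \is a GRing.unit.
Proof. by rewrite -(rmorph_nat (@mpolyC 2 rat)) rmorph_unit // unitfE pnatr_eq0. Qed.

(** * Two-state recursion for the weights *)

Section Weight.
Implicit Types (m t : nat) (g : pred nat).

(** The exponents are those of a deck of [m.+1] cards, the second one still without its summand
    [is_top g m]. *)
Definition weight m g : {mpoly rat[2]} :=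
  vX ^+ (\sum_(t < m) is_top g t && g t) * wX ^+ (\sum_(t < m) ~~ g t).

Definition top_weight m g := if is_top g m then weight m g else 0.
Definition bottom_weight m g := if is_top g m then 0 else weight m g.

Lemma set_coin_eq m b g : set_coin m b g m = b.
Proof. by rewrite /set_coin eqxx. Qed.

Lemma is_top_set_coin m b g t : (t <= m)%N -> is_top (set_coin m b g) t = is_top g t.
Proof. by case: t => //= t lttm; rewrite /set_coin ltn_eqF. Qed.

Lemma weight_set_coin m b g : weight m (set_coin m b g) = weight m g.
Proof.
rewrite /weight; congr (_ ^+ _ * _ ^+ _); apply: eq_bigr => t _.
  by rewrite is_top_set_coin 1?ltnW // /set_coin ltn_eqF.
by rewrite /set_coin ltn_eqF.
Qed.

(** Coin [m] decides card [m.+1]: a factor [vX] appears when cards [m] and [m.+1] are both up, a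
    factor [wX] when [m.+1] is not up. *)
Lemma weightS m b g : weight m.+1 (set_coin m b g) =
  (if b then vX * top_weight m g + bottom_weight m g
   else wX * (top_weight m g + bottom_weight m g)).
Proof.
rewrite /weight !big_ord_recr /= is_top_set_coin // set_coin_eq !exprD.
rewrite mulrACA -[X in X * _]/(weight m (set_coin m b g)) weight_set_coin.
rewrite /top_weight /bottom_weight; case: b; case: is_top => /=;
  rewrite ?expr0 ?expr1; ring.
Qed.

Definition top_mean m := mean m (top_weight m).
Definition bottom_mean m := mean m (bottom_weight m).

Lemma meanZ m (c : {mpoly rat[2]}) (G : pred nat -> {mpoly rat[2]}) :
  mean m (fun g => c * G g) = c * mean m G.
Proof. by rewrite !meanE -scalerAr mulr_sumr. Qed.

Lemma mean_zero m : mean m (fun=> 0 : {mpoly rat[2]}) = 0.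
Proof. by rewrite meanE big1 ?scaler0. Qed.

Lemma top_mean0 : top_mean 0 = 1.
Proof. by rewrite /top_mean mean0 /top_weight /= /weight !big_ord0 mulr1. Qed.

Lemma bottom_mean0 : bottom_mean 0 = 0.
Proof. by rewrite /bottom_mean mean0. Qed.

Lemma top_meanS m : top_mean m.+1 *+ 2 = vX * top_mean m + bottom_mean m.
Proof.
rewrite /top_mean meanS -meanZ -[RHS]meanD -[RHS]addr0 -(mean_zero m).
congr (_ + _); apply: eq_mean => g; rewrite /top_weight /= set_coin_eq //.
by rewrite weightS.
Qed.

Lemma bottom_meanS m : bottom_mean m.+1 *+ 2 = wX * (top_mean m + bottom_mean m).
Proof.
rewrite /bottom_mean meanS -[X in _ * X]meanD -meanZ -[RHS]add0r -(mean_zero m).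
congr (_ + _); apply: eq_mean => g; rewrite /bottom_weight /= set_coin_eq //.
by rewrite weightS.
Qed.

Lemma luck_cert_gfS m : luck_cert_gf m.+1 = wX * top_mean m + bottom_mean m.
Proof.
pose G g := wX * top_weight m g + bottom_weight m g.
transitivity (mean m.+1 G).
  apply: eq_bigr => om _; congr (_ *: _).
  rewrite pure_luckE certifiedE exprD mulrA -[X in X * _]/(weight m (coin om)).
  by rewrite /G /top_weight /bottom_weight; case: is_top => /=; ring.
(* [G] ignores coin [m], that of the largest card [m.+1], so averaging over it changes nothing. *)
have G_set b : mean m (fun g => G (set_coin m b g)) = mean m G.
  apply: eq_mean => g.
  by rewrite /G /top_weight /bottom_weight is_top_set_coin // weight_set_coin.
have := meanS m G; rewrite !G_set -mulr2n -[LHS]mulr_natl -[RHS]mulr_natl => /mulrI -> //.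
  by rewrite /G meanD meanZ.
exact: natr_mpoly_unit 1.
Qed.
End Weight.

(** * Power series and the closing algebra *)

Section Series.
Variable R : comUnitRingType.
Implicit Types (f g : fps R) (n : nat) (c : R).

Lemma fps_coefD f g n : (f + g) n = f n + g n.
Proof. by []. Qed.

Lemma fps_coefN f n : (- f) n = - f n.
Proof. by []. Qed.

Lemma fps_coef0M f g : (f * g) 0%N = f 0%N * g 0%N.
Proof. by rewrite /= big_ord1. Qed.

Lemma fps_coefMn f k n : (f *+ k) n = f n *+ k.
Proof. by elim: k => // k IHk; rewrite !mulrS fps_coefD IHk. Qed.

Lemma fps_unitE f : (f \is a GRing.unit) = (f 0%N \is a GRing.unit).
Proof. by []. Qed.

Lemma fps_coefCM c f n : (fpsC c * f) n = c * f n.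
Proof.
rewrite /= big_ord_recl /= subn0 big1 ?addr0 // => i _.
by rewrite mul0r.
Qed.

Lemma fps_coefXM f n : (fpsX R * f) n = if n is k.+1 then f k else 0.
Proof.
rewrite /=; case: n => [|n]; first by rewrite big_ord1 mul0r.
rewrite !big_ord_recl /= mul0r add0r mul1r subSS subn0 big1 ?addr0 // => i _.
by rewrite mul0r.
Qed.
End Series.

Lemma fraction_identity (A : comUnitRingType) (z v w : A) :
    let E : A := 1 - z * w / 2 in
    let D : A := 4 + w * (v - 1) * z ^+ 2 - 2 * z * (v + w) in
    (2 : A) \is a GRing.unit -> E \is a GRing.unit -> D \is a GRing.unit ->
  (z * w + (z ^+ 2 * w / 2) / E) / (1 - z * v / 2 - (z / 2) / E + z / 2)
  = 2 * z * w * (2 + (1 - w) * z) / D.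
Proof.
move=> E D unit2 unitE unitD.
have h2 : 2 * 2^-1 = 1 :> A by rewrite divrr.
have Ee : E * E^-1 = 1 by rewrite divrr.
have E2 : 2 * E = 2 - z * w.
  by rewrite /E mulrBr mulr1 [_ / 2]mulrC mulrA h2 mul1r.
(* The inverses become variables known only through [E * e = 1] and [2 * h = 1], so that [ring] can
   treat them. *)
move: (E^-1) Ee => e Ee; move: (2^-1 : A) h2 => h h2.
set D1 := _ + z * h; set N1 := z * w + _; set N := 2 * z * w * _.
have eqD : D = 4 * E * D1.
  (* The middle term pairs each inverse with its denominator: cancelling gives [D], expanding gives
     [4 * E * D1]. *)
  transitivity ((2 * E) * (2 - z * v * (2 * h) + z * (2 * h))
                - 2 * z * (2 * h) * (E * e)).
    by rewrite E2 h2 Ee /D; ring.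
  by rewrite /D1; ring.
have eqN : N = 4 * E * N1.
  transitivity ((2 * E) * (2 * z * w) + 2 * z ^+ 2 * w * (2 * h) * (E * e)).
    by rewrite E2 h2 Ee /N; ring.
  by rewrite /N1; ring.
have unitD1 : D1 \is a GRing.unit by move: unitD; rewrite eqD unitrM => /andP[].
apply: (mulIr unitD1); rewrite divrK // mulrAC.
by apply: (mulIr unitD); rewrite divrK // eqD eqN; ring.
Qed.

Lemma linear_system_solution (A : comUnitRingType) (z v w X Y : A) :
    2 * X = 2 + z * (v * X + Y) -> 2 * Y = z * (w * (X + Y)) ->
  z * (w * X + Y) * (4 + w * (v - 1) * z ^+ 2 - 2 * z * (v + w))
  = 2 * z * w * (2 + (1 - w) * z).
Proof.
move=> /eqP; rewrite -subr_eq0 => /eqP eqX /eqP; rewrite -subr_eq0 => /eqP eqY.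
apply/eqP; rewrite -subr_eq0; apply/eqP.
(* Cramer's rule: the multipliers are the rows of the adjugate of the system, combined with weights
   [z * w] and [z]; the determinant is the denominator. *)
transitivity ((z * w * (2 - z * w) + z * z * w) * (2 * X - (2 + z * (v * X + Y)))
  + (z * w * z + z * (2 - z * v)) * (2 * Y - z * (w * (X + Y)))); first by ring.
by rewrite eqX eqY !mulr0 addr0.
Qed.

Theorem lemma10 :
  let z : fps {mpoly rat[2]} := fpsX _ in
  let v : fps {mpoly rat[2]} := fpsC vX in
  let w : fps {mpoly rat[2]} := fpsC wX in
  let S : fps {mpoly rat[2]} := luck_cert_gf in
  S = (z * w + (z ^+ 2 * w / 2) / (1 - z * w / 2))
        / (1 - z * v / 2 - (z / 2) / (1 - z * w / 2) + z / 2)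
  /\
  (z * w + (z ^+ 2 * w / 2) / (1 - z * w / 2))
        / (1 - z * v / 2 - (z / 2) / (1 - z * w / 2) + z / 2)
  = 2 * z * w * (2 + (1 - w) * z)
      / (4 + w * (v - 1) * z ^+ 2 - 2 * z * (v + w)).
Proof.
move=> z v w S.
pose X : fps {mpoly rat[2]} := Fps top_mean.
pose Y : fps {mpoly rat[2]} := Fps bottom_mean.
have eqX : 2 * X = 2 + z * (v * X + Y).
  apply: fpsP => n; rewrite mulr_natl fps_coefMn fps_coefD fps_coefXM fps_coefMn.
  case: n => [|n]; first by rewrite addr0 [X 0%N]top_mean0.
  by rewrite fps_coefD fps_coefCM mul0rn add0r [X n.+1 *+ 2]top_meanS.
have eqY : 2 * Y = z * (w * (X + Y)).
  apply: fpsP => n; rewrite mulr_natl fps_coefMn fps_coefXM.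
  case: n => [|n]; first by rewrite [Y 0%N]bottom_mean0 mul0rn.
  by rewrite fps_coefCM fps_coefD [Y n.+1 *+ 2]bottom_meanS.
have eqS : S = z * (w * X + Y).
  apply: fpsP => -[|n]; rewrite fps_coefXM // fps_coefD fps_coefCM.
  exact: luck_cert_gfS.
have coefz : z 0%N = 0 by [].
(* Invertibility is read off the constant coefficients 2, 1 and 4. *)
have unit2 : (2 : fps {mpoly rat[2]}) \is a GRing.unit.
  rewrite fps_unitE fps_coefMn; exact: natr_mpoly_unit 1.
set E := 1 - z * w / 2; set D := 4 + _ - _.
have unitE : E \is a GRing.unit.
  rewrite fps_unitE fps_coefD fps_coefN !fps_coef0M coefz !mul0r subr0.
  exact: unitr1.
have unitD : D \is a GRing.unit.
  rewrite fps_unitE fps_coefD fps_coefN fps_coefD expr2 !fps_coef0M coefz.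
  rewrite !(mulr0, mul0r) subr0 addr0 fps_coefMn; exact: natr_mpoly_unit 3.
have eqND := fraction_identity unit2 unitE unitD.
split=> //; rewrite eqND.
apply: (mulIr unitD); rewrite divrK // eqS.
exact: linear_system_solution eqX eqY.
Qed.
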